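(* Let $\delta$ be an ordinary derivation of $\Bbbk_{-1}[x,y]$. Then $$\delta=[w,\_]+\lambda_1D_x+\lambda_2D_y$$ for some $w\in\Bbbk_{-1}[x,y]$ and $\lambda_1,\lambda_2\in Z(\Bbbk_{-1}[x,y])$, where $D_x,D_y$ are the derivations with $D_x(x)=x$, $D_x(y)=0$, $D_y(x)=0$, $D_y(y)=y$. Furthermore, the isotropy group $\mathrm{Aut}_\delta(\Bbbk_{-1}[x,y])$ is the union of its toric and flip parts, described as follows: (i) An automorphism $\rho_{\mu_1,\mu_2}(x)=\mu_1x$, $\rho_{\mu_1,\mu_2}(y)=\mu_2y$ (with $\mu_1,\mu_2\in\Bbbk^\ast$) belongs to the isotropy group of $\delta$ if and only if $\rho_{\mu_1,\mu_2}(w)-w\in Z(\Bbbk_{-1}[x,y])$, $\rho_{\mu_1,\mu_2}(\lambda_1)=\lambda_1$ and $\rho_{\mu_1,\mu_2}(\lambda_2)=\lambda_2$. (ii) An automorphism $\eta_{u,v}(x)=uy$, $\eta_{u,v}(y)=vx$ (with $u,v\in\Bbbk^\ast$) belongs to the isotropy group of $\delta$ if and only if $\eta_{u,v}(w)-w\in Z(\Bbbk_{-1}[x,y])$, $\eta_{u,v}(\lambda_2)=\lambda_1$ and $\eta_{u,v}(\lambda_1)=\lambda_2$.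
   Context: $\Bbbk$ is an algebraically closed field of characteristic zero. $\Bbbk_{-1}[x,y]$ is the $\Bbbk$-algebra generated by $x,y$ with the relation $xy=-yx$; its center is $Z(\Bbbk_{-1}[x,y])=\Bbbk[x^2,y^2]$. Every automorphism of $\Bbbk_{-1}[x,y]$ is either toric ($x\mapsto\mu_1x$, $y\mapsto\mu_2y$) or flip ($x\mapsto uy$, $y\mapsto vx$). An ordinary derivation is a $\Bbbk$-linear map $\delta$ with $\delta(ab)=\delta(a)b+a\delta(b)$; $[w,\_]$ is the inner derivation $b\mapsto wb-bw$; the isotropy group is $\mathrm{Aut}_\delta(\Bbbk_{-1}[x,y])=\{\rho\in\mathrm{Aut}(\Bbbk_{-1}[x,y]):\rho\delta=\delta\rho\}$. *)

(* Defs.v *)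
From HB Require Import structures.
From mathcomp Require Import all_boot all_order all_algebra.

Set Implicit Arguments.
Unset Strict Implicit.
Unset Printing Implicit Defensive.

Import GRing.Theory.
Local Open Scope ring_scope.

(* [skew_plane x y] : the k-algebra A, with the elements x and y, is the      *)
(* algebra k_{-1}[x,y] presented by the generators x, y and the single        *)
(* relation xy = -yx: the relation holds, x and y generate A, and every       *)
(* relation between x and y follows from it, i.e. any two elements of a       *)
(* k-algebra satisfying the relation are the images of x and y under a        *)
(* morphism of k-algebras. This determines (A, x, y) up to isomorphism.       *)
Record skew_plane (k : fieldType) (A : algType k) (x y : A) : Prop := SkewPlane {
  skew_plane_rel : x * y = - (y * x);
  skew_plane_gen : forall S : {pred A},
    GRing.subalg_closed S -> x \in S -> y \in S -> forall a : A, a \in S;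
  skew_plane_univ : forall (B : algType k) (a b : B), a * b = - (b * a) ->
    exists f : {lrmorphism A -> B}, f x = a /\ f y = b }.

Section SkewPlaneMaps.
Variables (k : fieldType) (A : algType k).
Implicit Types (x y z w : A) (mu nu : k).

Definition central z : Prop := forall a : A, z * a = a * z.

Definition is_derivation (d : {linear A -> A}) : Prop :=
  forall a b : A, d (a * b) = d a * b + a * d b.

Definition inner w (b : A) : A := w * b - b * w.

Definition is_automorphism (rho : {lrmorphism A -> A}) : Prop := bijective rho.

Definition isotropy (d : {linear A -> A}) (rho : {lrmorphism A -> A}) : Prop :=
  is_automorphism rho /\ (forall a : A, rho (d a) = d (rho a)).

Definition toric x y mu nu (rho : {lrmorphism A -> A}) : Prop :=
  rho x = mu *: x /\ rho y = nu *: y.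

Definition flip x y mu nu (rho : {lrmorphism A -> A}) : Prop :=
  rho x = mu *: y /\ rho y = nu *: x.

End SkewPlaneMaps.

(* Main.v *)
Require Import Defs.
From HB Require Import structures.
From mathcomp Require Import all_boot all_order all_algebra.
From mathcomp Require Import ring zify.

(** The algebra A = k_{-1}[x,y] is a generalised quaternion algebra over the
    polynomial ring P = k[s,t]: s = x^2 and t = y^2 are central, and 1, x, y, xy
    is a basis of A over P, with xy = -yx. The universal property gives a
    morphism f from A to this model, of which substitution of x^2 and y^2 gives
    a left inverse (skew_plane_model). The reduced norm
    N = a^2 - t c^2 - s (b^2 - t d^2) is multiplicative, and the parities of the
    degrees in s and t of its four terms differ, so that no leading term
    cancels: the degree in s of a norm is known exactly (size_qnorm), and A is a
    domain.

    Decomposition of a derivation. Expanding delta(xy + yx) = 0 in coordinates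
    leaves, besides b x and c' y, only terms that are commutators with a common
    element w (skew_plane_derivation). Both sides of the decomposition are
    derivations, so that it is enough to compare them at x and y.

    Automorphisms. All commutators lie in the ideal xyA, hence so does
    rho(x) rho(y), which is half a commutator; applying this to the inverse of
    rho also, rho(x) rho(y) = xy a with a a unit. Norms then give
    N(rho x) N(rho y) = const s t. As rho x and rho y anticommute, their scalar
    parts vanish (anticommute_pure), and the degrees leave only scalar multiples
    of x and y: rho is toric or a flip (skew_plane_automorphism).

    Isotropy conditions. rho delta and delta rho are both derivations along rho,
    so rho commutes with delta as soon as it does so at x and at y. At a
    generator z mapped to a multiple of z', this reads
    [rho w - w, z'] + (rho m - m') z' = 0, where m and m' are the coefficients
    that delta has at z and z'. The first term anticommutes with z' and the
    second commutes with it, so both vanish (commute_at). *)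

Set Implicit Arguments.
Unset Strict Implicit.
Unset Printing Implicit Defensive.

Import GRing.Theory.
Local Open Scope ring_scope.

(** * Generalised quaternion algebras *)

(** The algebra with basis 1, i, j, k = ij over [R], where i^2 = s, j^2 = t and
    ij = -ji; the four fields are the coordinates in this basis. *)
Record quat (R : comNzRingType) (s t : R) : Type :=
  Quaternion { qre : R; qi : R; qj : R; qk : R }.

Section Quat.
Variables (R : comNzRingType) (s t : R).
Local Notation Q := (quat s t).
Local Notation Quat := (@Quaternion R s t) (only parsing).
Implicit Types (a b c d r : R) (p q : Q).

Definition quat_tuple q := (qre q, qi q, qj q, qk q).
Definition tuple_quat (u : R * R * R * R) :=
  let: (a, b, c, d) := u in Quat a b c d.

Lemma quat_tupleK : cancel quat_tuple tuple_quat.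
Proof. by case. Qed.

HB.instance Definition _ := Choice.copy Q (can_type quat_tupleK).

Definition qadd p q :=
  Quat (qre p + qre q) (qi p + qi q) (qj p + qj q) (qk p + qk q).
Definition qopp q := Quat (- qre q) (- qi q) (- qj q) (- qk q).
Definition qmul p q :=
  let: Quaternion a b c d := p in let: Quaternion a' b' c' d' := q in
  Quat (a * a' + s * (b * b') + t * (c * c') - s * t * (d * d'))
       (a * b' + b * a' - t * (c * d') + t * (d * c'))
       (a * c' + c * a' + s * (b * d') - s * (d * b'))
       (a * d' + d * a' + b * c' - c * b').

Lemma qaddA : associative qadd.
Proof. by case=> ? ? ? ? [? ? ? ?] [? ? ? ?]; congr Quat; apply: addrA. Qed.
Lemma qaddC : commutative qadd.
Proof. by case=> ? ? ? ? [? ? ? ?]; congr Quat; apply: addrC. Qed.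
Lemma qadd0 : left_id (Quat 0 0 0 0) qadd.
Proof. by case=> ? ? ? ?; congr Quat; apply: add0r. Qed.
Lemma qaddN : left_inverse (Quat 0 0 0 0) qopp qadd.
Proof. by case=> ? ? ? ?; congr Quat; apply: addNr. Qed.

HB.instance Definition _ := GRing.isZmodule.Build Q qaddA qaddC qadd0 qaddN.

Lemma qmulA : associative qmul.
Proof. by case=> ? ? ? ? [? ? ? ?] [? ? ? ?]; congr Quat => /=; ring. Qed.
Lemma qmul1 : left_id (Quat 1 0 0 0) qmul.
Proof. by case=> ? ? ? ?; congr Quat => /=; ring. Qed.
Lemma qmulr1 : right_id (Quat 1 0 0 0) qmul.
Proof. by case=> ? ? ? ?; congr Quat => /=; ring. Qed.
Lemma qmulDl : left_distributive qmul +%R.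
Proof. by case=> ? ? ? ? [? ? ? ?] [? ? ? ?]; congr Quat => /=; ring. Qed.
Lemma qmulDr : right_distributive qmul +%R.
Proof. by case=> ? ? ? ? [? ? ? ?] [? ? ? ?]; congr Quat => /=; ring. Qed.
Lemma quat1_neq0 : Quat 1 0 0 0 != 0.
Proof. by apply/eqP => -[] /eqP; rewrite oner_eq0. Qed.

HB.instance Definition _ := GRing.Zmodule_isNzRing.Build Q
  qmulA qmul1 qmulr1 qmulDl qmulDr quat1_neq0.

Lemma quat_addE a b c d a' b' c' d' :
  Quat a b c d + Quat a' b' c' d' = Quat (a + a') (b + b') (c + c') (d + d').
Proof. by []. Qed.

Lemma quat_oppE a b c d : - Quat a b c d = Quat (- a) (- b) (- c) (- d).
Proof. by []. Qed.

Lemma quat_mulE a b c d a' b' c' d' :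
  Quat a b c d * Quat a' b' c' d' =
  Quat (a * a' + s * (b * b') + t * (c * c') - s * t * (d * d'))
       (a * b' + b * a' - t * (c * d') + t * (d * c'))
       (a * c' + c * a' + s * (b * d') - s * (d * b'))
       (a * d' + d * a' + b * c' - c * b').
Proof. by []. Qed.

Definition quatE := (quat_mulE, quat_addE, quat_oppE).

Definition qscal r := Quat r 0 0 0.

Lemma qscal_zmod_morphism : zmod_morphism qscal.
Proof. by move=> a b; rewrite /qscal !quatE; congr Quat => /=; ring. Qed.
Lemma qscal_monoid_morphism : monoid_morphism qscal.
Proof. by split=> // a b; rewrite /qscal !quatE; congr Quat => /=; ring. Qed.
HB.instance Definition _ :=
  GRing.isZmodMorphism.Build R Q qscal qscal_zmod_morphism.
HB.instance Definition _ :=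
  GRing.isMonoidMorphism.Build R Q qscal qscal_monoid_morphism.

Lemma qscalE r a b c d :
  qscal r * Quat a b c d = Quat (r * a) (r * b) (r * c) (r * d).
Proof. by rewrite /qscal quatE; congr Quat => /=; ring. Qed.

Lemma qscalC r q : qscal r * q = q * qscal r.
Proof. by case: q => *; rewrite /qscal !quatE; congr Quat => /=; ring. Qed.

(** The reduced norm: with q* = a - bi - cj - dk, this is the scalar q q*.
    It is grouped so as to exhibit the norm a^2 - t c^2 of the subalgebra R[j]
    twice: writing q = z + i z' with z, z' in R[j], it is N(z) - s N(z'). *)
Definition qnorm q : R :=
  qre q ^+ 2 - t * qj q ^+ 2 - s * (qi q ^+ 2 - t * qk q ^+ 2).

Lemma qnormM p q : qnorm (p * q) = qnorm p * qnorm q.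
Proof. by case: p q => ? ? ? ? [? ? ? ?]; rewrite quatE /qnorm /=; ring. Qed.

Lemma qnorm0 : qnorm 0 = 0.
Proof. by rewrite /qnorm -[0 in LHS]/(Quat 0 0 0 0) /=; ring. Qed.

(** Modulo [k = ij] the algebra becomes commutative, and [k] is normal: it
    commutes with the basis up to signs, so its ideal is its right ideal. *)
Lemma quat_commutator p q :
  exists h, p * q - q * p = Quat 0 0 0 1 * h.
Proof.
case: p q => a b c d [a' b' c' d'].
exists (Quat (b * c' - c * b') (- (b * d' - d * b')) (d * c' - c * d') 0 *+ 2).
by rewrite mulr2n !quatE; congr Quat => /=; ring.
Qed.

(** The extension to the quaternion algebra of a derivation [E] of [R] with
    [E s = 2 s] and [E t = 0] that maps i to i and j to 0; these two values are
    forced by i^2 = s and j^2 = t. *)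
Definition qdiff (E : R -> R) q :=
  let: Quaternion a b c d := q in Quat (E a) (E b + b) (E c) (E d + d).

Lemma qdiffM (E : R -> R) : {morph E : a b / a - b >-> a - b} ->
   (forall a b, E (a * b) = E a * b + a * E b) -> E s = 2%:R * s -> E t = 0 ->
   forall p q, qdiff E (p * q) = qdiff E p * q + p * qdiff E q.
Proof.
move=> EB EM Es Et.
have E0 : E 0 = 0 by rewrite -[X in E X](subrr 0) EB subrr.
have EN a : E (- a) = - E a by rewrite -sub0r EB E0 sub0r.
have ED a b : E (a + b) = E a + E b by rewrite -{1}(opprK b) EB EN opprK.
case=> a b c d [a' b' c' d'].
rewrite quatE /qdiff !quatE.
by congr Quat => /=; rewrite !(ED, EN, EM, Es, Et); ring.
Qed.

End Quat.

(** * The quaternion model of the skew plane *)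

Section Model.
Variable k : fieldType.
Local Notation P := {poly {poly k}}.
(** In k_{-1}[x,y] the subalgebra k[x^2,y^2] is central, and the algebra is
    free over it with basis 1, x, y, xy. The outer variable ['X] stands for x^2
    and the inner one ['X%:P] for y^2. *)
Definition model := quat ('X : P) ('X%:P : P).
HB.instance Definition _ := GRing.NzRing.on model.

Definition model_scale (c : k) (q : model) : model := qscal 'X 'X%:P c%:P%:P * q.

Lemma model_scaleA c c' q :
  model_scale c (model_scale c' q) = model_scale (c * c') q.
Proof. by rewrite /model_scale mulrA -rmorphM -!polyCM. Qed.
Lemma model_scale1 : left_id 1 model_scale.
Proof. by move=> q; rewrite /model_scale !rmorph1 mul1r. Qed.
Lemma model_scaleDr : right_distributive model_scale +%R.
Proof. by move=> c p q; rewrite /model_scale mulrDr. Qed.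
Lemma model_scaleDl q : {morph model_scale^~ q : c c' / c + c'}.
Proof. by move=> c c'; rewrite /model_scale !rmorphD mulrDl. Qed.
HB.instance Definition _ := GRing.Zmodule_isLmodule.Build k model
  model_scaleA model_scale1 model_scaleDr model_scaleDl.
Lemma model_scaleAl (c : k) (p q : model) : c *: (p * q) = (c *: p) * q.
Proof. exact: mulrA. Qed.
HB.instance Definition _ := GRing.Lmodule_isLalgebra.Build k model model_scaleAl.
Lemma model_scaleAr (c : k) (p q : model) : c *: (p * q) = p * (c *: q).
Proof. by rewrite [LHS]mulrA [_ * p]qscalC -mulrA. Qed.
HB.instance Definition _ := GRing.Lalgebra_isAlgebra.Build k model model_scaleAr.
End Model.

(** * Sizes of values of the norm form *)

(** The degree bounds need not be attained, so that the same [m] and [n] serve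
    for all the terms of a sum of products. *)
Lemma coefM_top (R : comNzRingType) (p q : {poly R}) m n :
  (size p <= m.+1)%N -> (size q <= n.+1)%N -> (p * q)`_(m + n) = p`_m * q`_n.
Proof.
move=> sp sq; have lt_m : (m < (m + n).+1)%N by rewrite ltnS leq_addr.
rewrite coefM (bigD1 (Ordinal lt_m)) //= big1 ?addr0 ?addKn // => i ne_im.
have [lt_im | le_mi] := ltnP i m.
  have -> : q`_(m + n - i) = 0 by apply: nth_default; apply: leq_trans sq _; lia.
  by rewrite mulr0.
have lt_mi : (m < i)%N by move: ne_im; rewrite -val_eqE /=; lia.
have -> : p`_i = 0 by apply: nth_default; apply: leq_trans sp _.
by rewrite mul0r.
Qed.

Lemma size_sqr (R : idomainType) (p : {poly R}) :
  size (p ^+ 2) = (2 * size p).-1.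
Proof.
have [->|nz] := eqVneq p 0; first by rewrite expr0n /= size_poly0.
by rewrite expr2 size_mul //; lia.
Qed.

(** Anisotropy of the form [a^2 - t c^2] over [R] prevents the cancellation of
    the top coefficients. *)
Lemma size_sqrB (R : idomainType) (t : R) (p q : {poly R}) :
    (forall a c, a ^+ 2 - t * c ^+ 2 = 0 -> a = 0 /\ c = 0) ->
  size (p ^+ 2 - t%:P * q ^+ 2) = (2 * maxn (size p) (size q)).-1.
Proof.
move=> anis; move Dm: (maxn (size p) (size q)) => m.
have [sp sq] : (size p <= m)%N /\ (size q <= m)%N.
  by rewrite -Dm leq_maxl leq_maxr.
case: m Dm sp sq => [|n] Dm sp sq.
  have /eqP -> : p == 0 by rewrite -size_poly_leq0.
  have /eqP -> : q == 0 by rewrite -size_poly_leq0.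
  by rewrite expr0n /= mulr0 subr0 size_poly0.
apply/eqP; rewrite eqn_leq; apply/andP; split.
  rewrite (leq_trans (size_polyD _ _)) // size_polyN mul_polyC geq_max.
  rewrite (leq_trans (size_scale_leq _ _)) size_sqr ?andbT; lia.
(* the coefficient of degree 2n is the form at the coefficients of degree n *)
rewrite mulnS /= mul2n -addnn ltnNge; apply/negP => /leq_sizeP/(_ _ (leqnn _)).
rewrite coefB mul_polyC coefZ !expr2 !coefM_top // -!expr2 => /anis[p0 q0].
have szS (u : {poly R}) : (size u <= n.+1)%N -> u`_n = 0 -> (size u <= n)%N.
  by move=> su u0; apply/leq_sizeP => i; rewrite leq_eqVlt => /predU1P[<-//|];
    apply/leq_sizeP.
have : (maxn (size p) (size q) <= n)%N by rewrite geq_max !szS.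
by rewrite Dm ltnn.
Qed.

(** The sizes of [p] and of ['X * q] are an odd and an even number (or zero),
    so the leading terms cannot cancel. *)
Lemma size_subMX (R : idomainType) (p q : {poly R}) m n :
  size p = (2 * m).-1 -> size q = (2 * n).-1 ->
  size (p - 'X * q) = maxn (2 * m).-1 (2 * n).
Proof.
move=> sp sq; have sXq : size (- ('X * q)) = (2 * n)%N.
  have [q0|nz_q] := eqVneq q 0.
    by move: sq; rewrite q0 mulr0 oppr0 size_poly0; lia.
  by rewrite size_polyN mulrC size_mulX // sq; have := size_poly_eq0 q;
    rewrite (negbTE nz_q) sq; lia.
have [lt | lt | eq] := ltngtP (2 * m).-1 (2 * n)%N.
- by rewrite addrC size_polyDl ?sXq ?sp.
- by rewrite size_polyDl ?sXq ?sp.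
- have [m0 n0] : m = 0%N /\ n = 0%N by lia.
  have /eqP -> : p == 0 by rewrite -size_poly_eq0 sp m0.
  have /eqP -> : q == 0 by rewrite -size_poly_eq0 sq n0.
  by rewrite mulr0 subr0 size_poly0 ?m0 ?n0.
Qed.

Lemma size_sqrBX (R : idomainType) (p q : {poly R}) :
  size (p ^+ 2 - 'X * q ^+ 2) = maxn (2 * size p).-1 (2 * size q).
Proof. by apply: size_subMX; apply: size_sqr. Qed.

Lemma sqrBX_anisotropic (R : idomainType) (p q : {poly R}) :
  p ^+ 2 - 'X * q ^+ 2 = 0 -> p = 0 /\ q = 0.
Proof.
move=> /(congr1 (size : {poly R} -> nat)); rewrite size_sqrBX size_poly0 => sz0.
by split; apply/eqP; rewrite -size_poly_eq0; lia.
Qed.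

Section ModelNorm.
Variable k : fieldType.
Local Notation P := {poly {poly k}}.
Implicit Types p q : model k.

(** The degree in x^2 of the norm is computed exactly by two uses of parity:
    degree in y^2 first, for the coefficients, then degree in x^2. *)
Lemma size_qnorm p : size (qnorm p) =
  maxn (2 * maxn (size (qre p)) (size (qj p))).-1
       (2 * maxn (size (qi p)) (size (qk p))).
Proof.
by rewrite /qnorm; apply: size_subMX; apply: size_sqrB; apply: sqrBX_anisotropic.
Qed.

Lemma qnorm_eq0 p : qnorm p = 0 -> p = 0.
Proof.
move=> /(congr1 (size : P -> nat)); rewrite size_qnorm size_poly0.
have arith m n m' n' : maxn (2 * maxn m n).-1 (2 * maxn m' n') = 0%N ->
  [/\ m = 0, n = 0, m' = 0 & n' = 0]%N by split; lia.
case: p => a b c d /arith[/= /eqP + /eqP + /eqP + /eqP].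
by rewrite !size_poly_eq0 => /eqP-> /eqP-> /eqP-> /eqP->.
Qed.

Lemma model_mul_eq0 p q : p * q = 0 -> p = 0 \/ q = 0.
Proof.
move=> pq0; have /eqP : qnorm p * qnorm q = 0 by rewrite -qnormM pq0 qnorm0.
by rewrite mulf_eq0 => /orP[/eqP/qnorm_eq0|/eqP/qnorm_eq0]; [left|right].
Qed.

End ModelNorm.

(** * Anticommuting pairs in the model *)

Section ModelPairs.
Variable k : fieldType.
Local Notation P := {poly {poly k}}.
Implicit Types p q : model k.

Definition mi : model k := Quaternion 'X ('X%:P : P) 0 1 0 0.
Definition mj : model k := Quaternion 'X ('X%:P : P) 0 0 1 0.

Lemma mi_mulE a b c d :
  mi * Quaternion _ _ a b c d = Quaternion _ _ ('X * b) a ('X * d) c.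
Proof. by rewrite /mi quat_mulE; congr Quaternion; ring. Qed.

Lemma mj_mulE a b c d :
  mj * Quaternion _ _ a b c d = Quaternion _ _ ('X%:P * c) (- ('X%:P * d)) a (- b).
Proof. by rewrite /mj quat_mulE; congr Quaternion; ring. Qed.

Lemma model_scaleE (l : k) a b c d :
  l *: (Quaternion _ _ a b c d : model k) =
  Quaternion _ _ (l%:P%:P * a) (l%:P%:P * b) (l%:P%:P * c) (l%:P%:P * d).
Proof. exact: qscalE. Qed.

(** Units of the model have a constant norm, since the units of
    k[x^2,y^2] are the constants. *)
Lemma qnorm_unit p q : qnorm p * qnorm q = 1 ->
  exists2 c : k, c != 0 & qnorm p = c%:P%:P.
Proof.
move=> pq1; have /size_poly1P[u nz_u Du] : size (qnorm p) == 1.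
  by move/(congr1 (size : P -> nat))/eqP: pq1;
    rewrite size_poly1 size_mul_eq1 => /andP[].
have /size_poly1P[v nz_v Dv] : size (qnorm q) == 1.
  by move/(congr1 (size : P -> nat))/eqP: pq1;
    rewrite size_poly1 size_mul_eq1 => /andP[].
move/eqP: pq1; rewrite Du Dv -polyCM -polyC1 => /eqP/polyC_inj.
move/(congr1 (size : {poly k} -> nat))/eqP.
by rewrite size_poly1 size_mul_eq1 => /andP[/size_poly1P[c nz_c ->] _]; exists c.
Qed.

(** Let a, a' be the scalar parts of [p], [q]. The coordinates of
    [p q + q p = 0] along i, j, k say that the pure part of [q], multiplied by
    [a], is [- a'] times that of [p]; multiplying the scalar coordinate by [a]
    and substituting turns it into [2 a' N(p) = 0]. *)
Lemma anticommute_pure p q : (2%:R : k) != 0 -> p != 0 -> p * q + q * p = 0 ->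
  qre q = 0.
Proof.
move=> nz2 nz_p; case: p nz_p => a b c d; case: q => a' b' c' d' nz_p.
rewrite !quatE => -[/= e0 e1 e2 e3].
have nzP : (2%:R : P) != 0 by rewrite -!polyC_natr !polyC_eq0.
set p := (X in X != 0) in nz_p.
have /eqP : 2%:R * (a' * qnorm p) = 0.
  (* 2 a' N(p) is the combination of the four coordinates with coefficients
     a, -s b, -t c and s t d *)
  by rewrite -[RHS](_ : a * 0 - 'X * b * 0 - 'X%:P * c * 0 + 'X * 'X%:P * d * 0 = 0);
    [rewrite -{1}e0 -{1}e1 -{1}e2 -e3 /qnorm /=; ring | ring].
rewrite !mulf_eq0 (negbTE nzP) /= => /orP[/eqP //|/eqP/qnorm_eq0 p0].
by rewrite p0 eqxx in nz_p.
Qed.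

(** The degree in x^2 of the norms leaves only coordinates in k[y^2], with
    [p = e j] and [q = b' i + e' j + d' k]. The coefficients of the powers of
    x^2 in [N(p) N(q)] then give [e' = 0] and
    [e^2 (b'^2 - y^2 d'^2) = c], which forces [e] and [b'] to be constants
    and [d'] to vanish. *)
Lemma pure_pair p q (c : k) :
    c != 0 -> qre p = 0 -> qre q = 0 ->
    size (qnorm p) = 1 -> size (qnorm q) = 2 ->
    qnorm p * qnorm q = c%:P%:P * ('X * 'X%:P) ->
  exists u v : k, [/\ u != 0, v != 0, p = u *: mj & q = v *: mi].
Proof.
move=> nz_c; case: p q => a b e d [a' b' e' d'] /= -> ->.
have arith1 m n m' n' : maxn (2 * maxn m n).-1 (2 * maxn m' n') = 1%N ->
  [/\ m' = 0, n' = 0 & n <= 1]%N by split; lia.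
have arith2 m n m' n' : maxn (2 * maxn m n).-1 (2 * maxn m' n') = 2%N ->
  [/\ m' <= 1, n' <= 1 & n <= 1]%N by split; lia.
rewrite !size_qnorm => /arith1[/= /eqP + /eqP + /size1_polyC De].
rewrite !size_poly_eq0 => /eqP -> /eqP ->.
move=> /arith2[/= /size1_polyC Db' /size1_polyC Dd' /size1_polyC De'].
move: (e`_0) (b'`_0) (e'`_0) (d'`_0) De Db' De' Dd' => E B E' D -> -> -> ->.
rewrite /qnorm /= => nEq.
have {}nEq : ('X ^+ 2 * E ^+ 2 * E' ^+ 2)%:P +
   ('X * E ^+ 2 * (B ^+ 2 - 'X * D ^+ 2))%:P * 'X = (c%:P * 'X)%:P * 'X :> P.
  have -> : (c%:P * 'X)%:P * 'X = c%:P%:P * ('X * 'X%:P) :> P.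
    by rewrite polyCM; ring.
  by rewrite -nEq !(polyCB, polyCM, polyC_exp); ring.
have := congr1 (fun u : P => u`_0) nEq; have := congr1 (fun u : P => u`_1) nEq.
rewrite !(coefD, coefMX, coefC) /= add0r addr0 => e1 /eqP.
have nzX : ('X : {poly k}) != 0 by rewrite polyX_eq0.
have {}e1 : E ^+ 2 * (B ^+ 2 - 'X * D ^+ 2) = c%:P.
  by apply: (mulfI nzX); rewrite mulrA e1 mulrC.
have nzE : E != 0.
  by apply: contra_neq nz_c => E0; move/esym/eqP: e1;
    rewrite E0 expr0n /= mul0r polyC_eq0 => /eqP.
rewrite !mulf_eq0 (negbTE nzX) (negbTE nzE) /= orbb => /eqP->.
move/(congr1 (size : {poly k} -> nat))/eqP: e1; rewrite size_polyC nz_c size_mul_eq1.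
rewrite size_sqr size_sqrBX.
have aE m : ((2 * m).-1 == 1)%N -> (m == 1)%N by lia.
have aBD m n : (maxn (2 * m).-1 (2 * n) == 1)%N -> (m == 1)%N && (n == 0)%N by lia.
case/andP=> /aE/size_poly1P[u nz_u ->] /aBD/andP[/size_poly1P[v nz_v ->]].
rewrite size_poly_eq0 => /eqP->; exists u, v; split=> //.
  by rewrite model_scaleE !mulr0 mulr1.
by rewrite model_scaleE !mulr0 mulr1.
Qed.

(** Images of the generators under an automorphism will meet these hypotheses.
    The norms have x^2-degrees of sum 1, whence the two cases. *)
Lemma anticommuting_pair p q (c : k) : (2%:R : k) != 0 -> c != 0 ->
    p * q + q * p = 0 -> qnorm p * qnorm q = c%:P%:P * ('X * 'X%:P) ->
  exists u v : k, [/\ u != 0, v != 0 &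
    (p = u *: mi /\ q = v *: mj) \/ (p = u *: mj /\ q = v *: mi)].
Proof.
move=> nz2 nz_c pq_qp nEq.
have nz_st : c%:P%:P * ('X * 'X%:P) != 0 :> P.
  by rewrite !mulf_neq0 ?polyX_eq0 ?polyC_eq0 ?polyX_eq0.
have /andP[nz_np nz_nq] : (qnorm p != 0) && (qnorm q != 0).
  by rewrite -negb_or -mulf_eq0 nEq.
have nz_p : p != 0 by apply: contra_neq nz_np => ->; apply: qnorm0.
have nz_q : q != 0 by apply: contra_neq nz_nq => ->; apply: qnorm0.
have q0 : qre q = 0 by apply: anticommute_pure pq_qp.
have p0 : qre p = 0 by apply: anticommute_pure nz_q _ => //; rewrite addrC.
have: (size (qnorm p) + size (qnorm q)).-1 = 2.
  rewrite -size_mul // nEq mulrA [_ * 'X]mulrC -mulrA size_mul ?polyX_eq0 //.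
    by rewrite size_polyX -polyCM size_polyC mulf_neq0 // ?polyC_eq0 ?polyX_eq0.
  by rewrite mulf_neq0 ?polyC_eq0 ?polyX_eq0.
rewrite -!(size_poly_gt0) in nz_np nz_nq.
have arith m n : (0 < m -> 0 < n -> (m + n).-1 = 2 ->
  (m = 2 /\ n = 1) \/ (m = 1 /\ n = 2))%N by lia.
case/(arith _ _ nz_np nz_nq) => -[sp sq].
  have [|v [u [nz_v nz_u -> ->]]] := pure_pair nz_c q0 p0 sq sp.
    by rewrite mulrC.
  by exists u, v; split=> //; left.
have [u [v [nz_u nz_v -> ->]]] := pure_pair nz_c p0 q0 sp sq nEq.
by exists u, v; split=> //; right.
Qed.

End ModelPairs.

(** * Embedding the skew plane in the quaternion model *)

Section PlaneMaps.
Variables (k : fieldType) (A : algType k) (x y : A).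
Hypothesis Axy : skew_plane x y.

Lemma skew_plane_swap : skew_plane y x.
Proof.
split=> [|S S_alg Sy Sx|B a b ab]; first by rewrite (skew_plane_rel Axy) opprK.
  exact: (skew_plane_gen Axy S_alg).
have [|f [fx fy]] := skew_plane_univ Axy (a := b) (b := a); last by exists f.
by rewrite ab opprK.
Qed.

(** Derivations along a morphism [r] are determined by the generators, because
    two of them agree on a subalgebra. This covers both derivations of [A] and
    the composites of a derivation with an automorphism. *)
Lemma skew_plane_ext (B : algType k) (r : {lrmorphism A -> B}) (F G : A -> B) :
    linear F -> linear G ->
    (forall a b, F (a * b) = F a * r b + r a * F b) ->
    (forall a b, G (a * b) = G a * r b + r a * G b) ->
  F x = G x -> F y = G y -> F =1 G.
Proof.
move=> Flin Glin FM GM Fx Fy a.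
have F1 (H : A -> B) : (forall a b, H (a * b) = H a * r b + r a * H b) -> H 1 = 0.
  move=> HM; have := HM 1 1.
  by rewrite rmorph1 !mulr1 mul1r => /(congr1 (fun u => u - H 1));
    rewrite addrK subrr.
suff : a \in [pred a | F a == G a] by move/eqP.
apply: (skew_plane_gen Axy); rewrite ?inE ?Fx ?Fy //; split.
- by rewrite inE (F1 _ FM) (F1 _ GM).
- by move=> c u v; rewrite !inE Flin Glin => /eqP-> /eqP->.
- by move=> u v; rewrite !inE FM GM => /eqP-> /eqP->.
Qed.

Lemma skew_plane_central z : z * x = x * z -> z * y = y * z -> central z.
Proof.
move=> zx zy a; suff : a \in [pred a | z * a == a * z] by move/eqP.
apply: (skew_plane_gen Axy); rewrite ?inE ?zx ?zy //; split.
- by rewrite inE mulr1 mul1r.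
- move=> c u v; rewrite !inE mulrDr mulrDl -scalerAl -scalerAr.
  by move=> /eqP-> /eqP->.
- by move=> u v; rewrite !inE mulrA => /eqP-> /eqP zv; rewrite -!mulrA zv.
Qed.

Lemma central_sqrx : central (x * x).
Proof.
apply: skew_plane_central; first by rewrite mulrA.
by rewrite -mulrA (skew_plane_rel Axy) mulrN [X in - X]mulrA (skew_plane_rel Axy)
  mulNr opprK mulrA.
Qed.

Lemma centralD (a b : A) : central a -> central b -> central (a + b).
Proof. by move=> ca cb c; rewrite mulrDl mulrDr ca cb. Qed.

Lemma centralM (a b : A) : central a -> central b -> central (a * b).
Proof. by move=> ca cb c; rewrite -mulrA cb mulrA ca mulrA. Qed.

Lemma central_scalar (c : k) : central (c%:A : A).
Proof. by move=> a; rewrite mulr_algl mulr_algr. Qed.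

Lemma central_horner (z : A) p : central z -> central (horner_alg z p).
Proof.
move=> cz; elim/poly_ind: p => [|p c IHp].
  by move=> a; rewrite rmorph0 mulr0 mul0r.
rewrite rmorphD rmorphM /= horner_algX horner_algC.
by apply: centralD; [apply: centralM|apply: central_scalar].
Qed.

End PlaneMaps.

Section PlaneModel.
Variables (k : fieldType) (A : algType k) (x y : A).
Hypothesis Axy : skew_plane x y.
Local Notation P := {poly {poly k}}.

Lemma sqrx_comm : commr_rmorph (horner_alg (y * y)) (x * x).
Proof. by move=> p; apply: central_sqrx Axy _. Qed.

Definition plane_eval : P -> A := horner_morph sqrx_comm.
HB.instance Definition _ := GRing.RMorphism.on plane_eval.

Lemma plane_evalC p : plane_eval p%:P = horner_alg (y * y) p.
Proof. exact: horner_morphC. Qed.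

Lemma plane_evalX : plane_eval 'X = x * x.
Proof. exact: horner_morphX. Qed.

Lemma plane_evalY : plane_eval 'X%:P = y * y.
Proof. by rewrite plane_evalC horner_algX. Qed.

Lemma plane_eval_central p : central (plane_eval p).
Proof.
elim/poly_ind: p => [|p c IHp].
  by move=> a; rewrite rmorph0 mulr0 mul0r.
rewrite rmorphD rmorphM /= plane_evalX plane_evalC.
apply: centralD; first by apply: centralM => //; apply: central_sqrx Axy.
by apply/central_horner/(central_sqrx (skew_plane_swap Axy)).
Qed.

(** This is a morphism of algebras from the model to [A]; as the universal
    property provides one in the other direction, [A] embeds into the model. *)
Definition of_model (q : model k) : A :=
  plane_eval (qre q) + plane_eval (qi q) * x + plane_eval (qj q) * y
    + plane_eval (qk q) * (x * y).

Lemma of_modelD : {morph of_model : p q / p + q}.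
Proof.
case=> a b c d [a' b' c' d']; rewrite /of_model /= !rmorphD !mulrDl /=.
by rewrite [X in X + _ + _]addrACA [X in X + _]addrACA [LHS]addrACA.
Qed.

Lemma of_model_scal p q :
  of_model (qscal 'X 'X%:P p * q) = plane_eval p * of_model q.
Proof.
by case: q => a b c d; rewrite qscalE /of_model /= !rmorphM /= !mulrDr !mulrA.
Qed.

Lemma eval_mulC (u v : A) p : u * (plane_eval p * v) = plane_eval p * (u * v).
Proof. by rewrite mulrA -plane_eval_central -mulrA. Qed.

Lemma of_model_i q : of_model (mi k * q) = x * of_model q.
Proof.
case: q => a b c d; rewrite mi_mulE /of_model /=.
rewrite 2!(rmorphM plane_eval) /= plane_evalX.
rewrite !mulrDr !eval_mulC -!plane_eval_central -mulrA (mulrA x x y).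
by rewrite [X in X + _ + _]addrC addrAC.
Qed.

Lemma of_model_j q : of_model (mj k * q) = y * of_model q.
Proof.
have yx : y * x = - (x * y) := skew_plane_rel (skew_plane_swap Axy).
case: q => a b c d; rewrite mj_mulE /of_model /=.
rewrite 2!(rmorphN plane_eval) 2!(rmorphM plane_eval) /=.
rewrite plane_evalY !mulrDr !eval_mulC -!plane_eval_central yx.
rewrite (mulrA y x y) yx !mulNr !mulrN -!mulrA.
rewrite -(central_sqrx (skew_plane_swap Axy) x).
by rewrite (mulrA y y x) -[LHS]addrA [LHS]addrC addrA.
Qed.

(** It suffices to multiply on the left by scalars, i and j. *)
Lemma of_modelM : {morph of_model : p q / p * q}.
Proof.
move=> p q; case: p => a b c d.
have qE : Quaternion _ _ a b c d = qscal 'X 'X%:P a + qscal 'X 'X%:P b * mi k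
    + qscal 'X 'X%:P c * mj k + qscal 'X 'X%:P d * (mi k * mj k).
  by rewrite /mi /mj quat_mulE !qscalE /qscal !quatE; congr Quaternion => /=; ring.
rewrite [X in of_model (X * q)]qE 3!(mulrDl _ _ q) 3!of_modelD.
have scalM r m :
    of_model (qscal 'X 'X%:P r * m * q) = plane_eval r * of_model (m * q).
  by rewrite -mulrA of_model_scal.
rewrite -[of_model (Quaternion _ _ a b c d)]/(plane_eval a + plane_eval b * x
    + plane_eval c * y + plane_eval d * (x * y)).
rewrite 3!(mulrDl _ _ (of_model q)); congr (_ + _ + _ + _).
- exact: of_model_scal.
- by rewrite scalM of_model_i mulrA.
- by rewrite scalM of_model_j mulrA.
- by rewrite scalM -(mulrA (mi k)) of_model_i of_model_j !mulrA.
Qed.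

Lemma of_model1 : of_model 1 = 1.
Proof.
rewrite -[1 in LHS]/(Quaternion _ _ 1 0 0 0) /of_model /=.
by rewrite rmorph1 !rmorph0 !mul0r !addr0.
Qed.

Lemma of_model_zmod : zmod_morphism of_model.
Proof.
by move=> p q; apply: (addIr (of_model q)); rewrite -of_modelD !subrK.
Qed.

Lemma of_model_monoid : monoid_morphism of_model.
Proof. by split; [apply: of_model1 | apply: of_modelM]. Qed.

Lemma of_modelZ : scalable of_model.
Proof.
move=> c q; rewrite [LHS](of_model_scal c%:P%:P) plane_evalC horner_algC.
exact: mulr_algl.
Qed.

HB.instance Definition _ :=
  GRing.isZmodMorphism.Build (model k) A of_model of_model_zmod.
HB.instance Definition _ :=
  GRing.isMonoidMorphism.Build (model k) A of_model of_model_monoid.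
HB.instance Definition _ :=
  GRing.isScalable.Build k (model k) A *:%R of_model of_modelZ.

(** The composite [g \o f] is a morphism fixing both generators, hence the
    identity. The injectivity of [f] and the retraction [g] transport
    computations from the model to [A]. *)
Lemma skew_plane_model :
  exists (f : {lrmorphism A -> model k}) (g : {lrmorphism model k -> A}),
    cancel f g /\ [/\ f x = mi k, f y = mj k, g (mi k) = x & g (mj k) = y].
Proof.
have gi : of_model (mi k) = x by rewrite -[mi k]mulr1 of_model_i of_model1 mulr1.
have gj : of_model (mj k) = y by rewrite -[mj k]mulr1 of_model_j of_model1 mulr1.
have [|f [fx fy]] := skew_plane_univ Axy (a := mi k) (b := mj k).
  by rewrite /mi /mj !quatE; congr Quaternion => /=; ring.
exists f, of_model; split=> // a.
suff : a \in [pred a | of_model (f a) == a] by move/eqP.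
apply: (skew_plane_gen Axy); rewrite ?inE ?fx ?fy ?gi ?gj //; split.
- by rewrite inE !rmorph1.
- by move=> c u v; rewrite !inE !linearP /= => /eqP-> /eqP->.
- by move=> u v; rewrite !inE !rmorphM /= => /eqP-> /eqP->.
Qed.

End PlaneModel.

(** * Derivations and automorphisms of the skew plane *)

Section Plane.
Variables (k : fieldType) (A : algType k) (x y : A).
Hypothesis Axy : skew_plane x y.
Hypothesis nz2 : (2%:R : k) != 0.
Implicit Types (a b w m z : A).

Lemma mulr2_eq0 a : a + a = 0 -> a = 0.
Proof.
by move=> /eqP; rewrite -mulr2n -scaler_nat scaler_eq0 (negbTE nz2) => /eqP.
Qed.

Lemma skew_plane_domain a b : a * b = 0 -> a = 0 \/ b = 0.
Proof.
have [f [g [fK _]]] := skew_plane_model Axy.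
have f_inj := can_inj fK.
move=> /(congr1 f); rewrite rmorph0 rmorphM => /model_mul_eq0[] f0; [left|right];
  by apply: f_inj; rewrite f0 rmorph0.
Qed.

Lemma skew_plane_x_neq0 : x != 0.
Proof.
have [f [g [fK [fx _ _ _]]]] := skew_plane_model Axy.
apply/eqP => x0; have := fx; rewrite x0 rmorph0 => -[/eqP].
by rewrite eq_sym oner_eq0.
Qed.

Lemma skew_plane_commutator a b : exists h, a * b - b * a = x * y * h.
Proof.
have [f [g [fK [_ _ gi gj]]]] := skew_plane_model Axy.
have [h Dh] := quat_commutator (f a) (f b).
exists (g h); rewrite -(fK (_ - _)) rmorphB !rmorphM /= Dh rmorphM /=; congr (_ * _).
rewrite -gi -gj -rmorphM; congr (g _).
by rewrite /mi /mj quatE; congr Quaternion => /=; ring.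
Qed.

(** Such a product is half a commutator. *)
Lemma anticommuting_mul a b : a * b = - (b * a) -> exists h, a * b = x * y * h.
Proof.
move=> ab; have [h Dh] := skew_plane_commutator a b.
exists ((2%:R^-1 : k) *: h); rewrite -scalerAr -Dh.
have -> : b * a = - (a * b) by rewrite ab opprK.
by rewrite opprK -mulr2n -scaler_nat scalerA mulVf // scale1r.
Qed.

(** By [anticommuting_mul], [rho x * rho y = x y a]; the same for the inverse of
    [rho] gives [x y = x y a (rho b)], so that [a] is a unit and has constant
    norm. Thus [rho x] and [rho y] anticommute and their norms multiply to a
    constant times [N(x y) = x^2 y^2]. *)
Lemma skew_plane_automorphism (rho : {lrmorphism A -> A}) : is_automorphism rho ->
  exists u v : k, [/\ u != 0, v != 0 & toric x y u v rho \/ flip x y u v rho].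
Proof.
case=> rho' rhoK rhoK'.
have [f [g [fK [fx fy gi gj]]]] := skew_plane_model Axy.
have relxy := skew_plane_rel Axy.
have rxy : rho x * rho y = - (rho y * rho x) by rewrite -!rmorphM relxy rmorphN.
have rxy' : rho' x * rho' y = - (rho' y * rho' x).
  by apply: (can_inj rhoK); rewrite rmorphN !rmorphM /= !rhoK'.
have [a Da] := anticommuting_mul rxy; have [b Db] := anticommuting_mul rxy'.
have Dxy : x * y = x * y * a * rho b.
  by rewrite -Da -!rmorphM -Db rmorphM /= !rhoK'.
have nxy : qnorm (f (x * y)) = 'X * 'X%:P.
  by rewrite rmorphM /= fx fy /mi /mj quat_mulE /qnorm /=; ring.
have [c nz_c Dc] : exists2 c : k, c != 0 & qnorm (f a) = c%:P%:P.
  apply: (@qnorm_unit _ _ (f (rho b))).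
  have nz_st : ('X * 'X%:P : {poly {poly k}}) != 0.
    by rewrite mulf_neq0 ?polyX_eq0 ?polyC_eq0 ?polyX_eq0.
  apply: (mulfI nz_st).
  by rewrite mulr1 -nxy mulrA -!qnormM -!(rmorphM f) -Dxy.
have [||u [v [nz_u nz_v fE]]] :=
    @anticommuting_pair _ (f (rho x)) (f (rho y)) c nz2 nz_c.
- by rewrite -!(rmorphM f) -rmorphD rxy addNr rmorph0.
- by rewrite -qnormM -(rmorphM f) Da rmorphM qnormM nxy Dc mulrC.
have fZ (l : k) z q : f z = q -> f (l *: z) = l *: q.
  by move=> <-; exact: linearZ.
exists u, v; split=> //.
case: fE => -[fX fY]; [left|right]; split; apply: (can_inj fK).
- exact: etrans fX (esym (fZ _ _ _ fx)).
- exact: etrans fY (esym (fZ _ _ _ fy)).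
- exact: etrans fX (esym (fZ _ _ _ fy)).
- exact: etrans fY (esym (fZ _ _ _ fx)).
Qed.

Lemma innerM w a b : inner w (a * b) = inner w a * b + a * inner w b.
Proof. by rewrite /inner mulrBl mulrBr !mulrA addrA subrK. Qed.

Lemma inner_linear w : linear (inner w).
Proof.
move=> c a b; rewrite /inner mulrDr mulrDl -scalerAl -scalerAr opprD addrACA.
by rewrite scalerBr.
Qed.

Lemma central_inner w : inner w x = 0 -> inner w y = 0 -> central w.
Proof. by move=> /subr0_eq wx /subr0_eq wy; apply: (skew_plane_central Axy). Qed.

(** As [z^2] is central, [inner w z] anticommutes with [z], while [m z]
    commutes with it: anticommuting the relation with [z] gives
    [2 m z^2 = 0]. *)
Lemma inner_add_central_eq0 w m z : central (z * z) -> z != 0 -> central m ->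
  inner w z + m * z = 0 -> inner w z = 0 /\ m = 0.
Proof.
move=> czz nz_z cm eq0.
suff m0 : m = 0 by move: eq0; rewrite m0 mul0r addr0.
have : m * z * z + m * z * z = 0.
  have: (inner w z + m * z) * z + z * (inner w z + m * z) = 0.
    by rewrite eq0 mul0r mulr0 addr0.
  rewrite mulrDl mulrDr addrACA -[X in X + _ = 0]innerM {1}/inner czz subrr add0r.
  by rewrite [z * (m * z)]mulrA -(cm z).
move/mulr2_eq0/skew_plane_domain; case=> [/skew_plane_domain[//|z0]|z0];
  by rewrite z0 eqxx in nz_z.
Qed.

(** The equation [rho (delta z) = delta (rho z)], divided by [mu], reads
    [inner (rho w - w) z' + (rho m - m') z' = 0], and its two terms vanish
    separately. The toric case has [z' = z] and [m' = m]; the flip exchanges the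
    two generators and the two coefficients. *)
Lemma commute_at (delta : {linear A -> A}) (rho : {lrmorphism A -> A})
    w m m' z z' (mu : k) :
    mu != 0 -> z' != 0 -> central (z' * z') -> central (rho m) -> central m' ->
    rho z = mu *: z' ->
    delta z = inner w z + m * z -> delta z' = inner w z' + m' * z' ->
  rho (delta z) = delta (rho z) <-> inner (rho w - w) z' = 0 /\ rho m = m'.
Proof.
move=> nz_mu nz_z czz crm cm' rz dz dz'.
have -> : rho (delta z) = mu *: (inner (rho w) z' + rho m * z').
  by rewrite dz rmorphD /inner rmorphB !rmorphM /= rz
    -!scalerAr -scalerAl -scalerBr -scalerDr.
rewrite rz linearZ /= dz'.
have D : inner (rho w) z' + rho m * z' - (inner w z' + m' * z')
    = inner (rho w - w) z' + (rho m - m') * z'.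
  by rewrite opprD addrACA /inner !mulrBl mulrBr !opprD !opprK [X in X + _]addrACA.
split=> [/(scalerI nz_mu) E|[i0 Dm]].
  move: D; rewrite E subrr => /esym/inner_add_central_eq0[] //.
    by move=> a; rewrite mulrBl mulrBr crm cm'.
  by move=> -> /subr0_eq.
congr (_ *: _); apply: subr0_eq; by rewrite D i0 Dm subrr mul0r addr0.
Qed.

End Plane.

Section PlaneDerivations.
Variables (k : fieldType) (A : algType k) (x y : A).
Hypothesis Axy : skew_plane x y.
Implicit Types (a b w m z : A).

(** The derivation [2 s d/ds] of k[s,t], where [s] = x^2, extends to the
    quaternion model. The derivation for the other generator comes from
    [skew_plane_swap]. *)
Lemma skew_plane_euler :
  exists D : {linear A -> A}, [/\ is_derivation D, D x = x & D y = 0].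
Proof.
have [f [g [fK [fx fy gi gj]]]] := skew_plane_model Axy.
pose E (p : {poly {poly k}}) := 2%:R * 'X * p^`().
have EB : {morph E : p q / p - q} by move=> p q; rewrite /E derivB mulrBr.
have EM p q : E (p * q) = E p * q + p * E q by rewrite /E derivM; ring.
have EX : E 'X = 2%:R * 'X by rewrite /E derivX mulr1.
have EC c : E c%:P = 0 by rewrite /E derivC mulr0.
have E0 : E 0 = 0 by rewrite -polyC0 EC.
have E1 : E 1 = 0 by exact: (EC 1).
pose d : model k -> model k := qdiff E.
have dM p q : d (p * q) = d p * q + p * d q by exact: qdiffM.
have ED p q : E (p + q) = E p + E q by rewrite /E derivD mulrDr.
have dD p q : d (p + q) = d p + d q.
  by case: p q => ? ? ? ? [? ? ? ?]; congr Quaternion => /=; rewrite ED; ring.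
have dZ c q : d (c *: q) = c *: d q.
  have dc : d (c%:A) = 0.
    by rewrite model_scaleE /d /= !(mulr0, mulr1) E0 EC addr0.
  by rewrite -[c *: q]mulr_algl dM dc mul0r add0r mulr_algl.
have Dlin : linear (fun a => g (d (f a))).
  by move=> c a b; rewrite linearP dD dZ linearP.
pose DL := GRing.isLinear.Build k A A *:%R _ Dlin.
pose D : {linear A -> A} := HB.pack (fun a => g (d (f a))) DL.
exists D; split.
- by move=> a b; rewrite /D /= rmorphM dM rmorphD !rmorphM /= !fK.
- by rewrite /D /= fx /mi /d /= E0 E1 !add0r; exact: gi.
- by rewrite /D /= fy /mj /d /= E0 E1 addr0; exact: (rmorph0 g).
Qed.

Hypothesis nz2 : (2%:R : k) != 0.

(** In coordinates, the relation [delta (x y + y x) = 0] says that the scalar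
    parts of [delta x] = bi + cj + dk and [delta y] = b'i + c'j + d'k vanish
    and that y^2 c + x^2 b' = 0. By coprimality c = x^2 e and b' = - y^2 e, and
    the terms other than bi and c'j are [w, i] and [w, j] for
    w = (d' i - d j - e k)/2. *)
Lemma skew_plane_derivation (delta : {linear A -> A}) : is_derivation delta ->
  exists w l1 l2 : A, [/\ central l1, central l2,
    delta x = inner w x + l1 * x & delta y = inner w y + l2 * y].
Proof.
move=> deltaM; have [f [g [fK [fx fy gi gj]]]] := skew_plane_model Axy.
have relxy : delta (x * y) + delta (y * x) = 0.
  by rewrite (skew_plane_rel Axy) linearN addNr.
have gscal_central r : central (g (qscal 'X 'X%:P r)).
  by move=> a; rewrite -(fK a) -!rmorphM qscalC.
have := fK (delta x); have := fK (delta y); move: relxy.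
rewrite !deltaM => /(congr1 f); rewrite !rmorphD !rmorphM /= fx fy rmorph0.
case: (f (delta x)) (f (delta y)) => a b c d [a' b' c' d'].
rewrite /mi /mj !quatE => -[/= r0 r1 r2 _].
have cancel2 (p : {poly {poly k}}) : 2%:R * p = 0 -> p = 0.
  move/eqP; rewrite mulf_eq0 -[2%:R]polyC_natr polyC_eq0 -[2%:R]polyC_natr polyC_eq0.
  by rewrite (negbTE nz2) => /eqP.
have {r2}a0 : a = 0 by apply: cancel2; rewrite -r2; ring.
have {r1}a'0 : a' = 0 by apply: cancel2; rewrite -r1; ring.
have {r0}bc : 'X%:P * c + 'X * b' = 0 by apply: cancel2; rewrite -r0; ring.
(* [root c 0] at the outer variable: c is divisible by x^2 *)
have /factor_theorem[e] : root c 0.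
  apply/eqP/(mulfI (_ : 'X != 0 :> {poly k})); first by rewrite polyX_eq0.
  move: (congr1 (horner^~ 0) bc).
  by rewrite hornerD !hornerM hornerC hornerX horner0 mul0r addr0 mulr0.
rewrite subr0 => Dc; have Db' : b' = - ('X%:P * e).
  have /mulfI : ('X : {poly {poly k}}) != 0 by rewrite polyX_eq0.
  by apply; apply: (addrI ('X%:P * c)); rewrite bc Dc; ring.
have half (p : {poly {poly k}}) : exists q, p = q + q.
  exists ((2%:R^-1)%:P%:P * p); rewrite -mulrDl -!polyCD.
  rewrite -{1 2}[2%:R^-1]mul1r -mulrDl.
  by rewrite mulfV // mul1r.
have [d1 Dd] := half d; have [d1' Dd'] := half d'; have [e1 De] := half e.
pose W : model k := Quaternion _ _ 0 d1' (- d1) (- e1).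
move=> <- <-; exists (g W), (g (qscal 'X 'X%:P b)), (g (qscal 'X 'X%:P c')).
split=> //.
  have -> : inner (g W) x + g (qscal 'X 'X%:P b) * x
      = g (W * mi k - mi k * W + qscal 'X 'X%:P b * mi k).
    by rewrite (rmorphD g) (rmorphB g) 3!(rmorphM g) /= gi.
  congr (g _).
  by rewrite a0 Dc Dd De /mi /W /qscal !quatE; congr Quaternion => /=; ring.
have -> : inner (g W) y + g (qscal 'X 'X%:P c') * y
    = g (W * mj k - mj k * W + qscal 'X 'X%:P c' * mj k).
  by rewrite (rmorphD g) (rmorphB g) 3!(rmorphM g) /= gj.
congr (g _).
by rewrite a'0 Db' Dd' De /mj /W /qscal !quatE; congr Quaternion => /=; ring.
Qed.

End PlaneDerivations.

Theorem corollary20 (k : closedFieldType) (k_char0 : [pchar k] =i pred0)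
    (A : algType k) (x y : A) (A_plane : skew_plane x y) :
  exists Dx Dy : {linear A -> A},
    [/\ is_derivation Dx, Dx x = x & Dx y = 0] /\
    [/\ is_derivation Dy, Dy x = 0 & Dy y = y] /\
    forall delta : {linear A -> A}, is_derivation delta ->
      (exists w l1 l2 : A, [/\ central l1, central l2 &
         forall a : A, delta a = inner w a + l1 * Dx a + l2 * Dy a]) /\
      (forall rho : {lrmorphism A -> A},
         isotropy delta rho <->
         (isotropy delta rho /\
            exists mu1 mu2 : k, [/\ mu1 != 0, mu2 != 0 & toric x y mu1 mu2 rho]) \/
         (isotropy delta rho /\
            exists u v : k, [/\ u != 0, v != 0 & flip x y u v rho])) /\
      (forall w l1 l2 : A, central l1 -> central l2 ->
         (forall a : A, delta a = inner w a + l1 * Dx a + l2 * Dy a) ->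
         (forall (mu1 mu2 : k) (rho : {lrmorphism A -> A}),
            mu1 != 0 -> mu2 != 0 -> is_automorphism rho ->
            toric x y mu1 mu2 rho ->
            (isotropy delta rho <->
             [/\ central (rho w - w), rho l1 = l1 & rho l2 = l2])) /\
         (forall (u v : k) (eta : {lrmorphism A -> A}),
            u != 0 -> v != 0 -> is_automorphism eta ->
            flip x y u v eta ->
            (isotropy delta eta <->
             [/\ central (eta w - w), eta l2 = l1 & eta l1 = l2]))).
Proof.
have nz2 : (2%:R : k) != 0 by rewrite (proj1 (pcharf0P k) k_char0).
have yx_plane := skew_plane_swap A_plane.
have [Dx [DxM Dxx Dxy]] := skew_plane_euler A_plane.
have [Dy [DyM Dyy Dyx]] := skew_plane_euler yx_plane.
exists Dx, Dy; split=> //; split=> // delta deltaM; split; [|split].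
- have [w [l1 [l2 [cl1 cl2 dx dy]]]] := skew_plane_derivation A_plane nz2 deltaM.
  exists w, l1, l2; split=> //.
  apply: (skew_plane_ext A_plane (r := idfun)) => //=.
  + exact: linearP.
  + move=> c a b; rewrite inner_linear !linearP /= !mulrDr -!scalerAr.
    by rewrite !scalerDr [X in X + _ = _]addrACA [LHS]addrACA.
  + move=> a b; rewrite innerM DxM DyM !mulrDr !mulrDl.
    rewrite (mulrA l1 a) (cl1 a) (mulrA l2 a) (cl2 a) !mulrA.
    by rewrite [X in X + _ = _]addrACA [LHS]addrACA.
  + by rewrite Dxx Dyx mulr0 addr0.
  + by rewrite Dxy Dyy mulr0 addr0.
- move=> rho; split=> [iso|[[]|[]] //].
  have [u [v [nz_u nz_v uv]]] := skew_plane_automorphism A_plane nz2 iso.1.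
  by case: uv => uv; [left|right]; split=> //; exists u, v.
move=> w l1 l2 cl1 cl2 deltaE.
have dx : delta x = inner w x + l1 * x by rewrite deltaE Dxx Dyx mulr0 addr0.
have dy : delta y = inner w y + l2 * y by rewrite deltaE Dxy Dyy mulr0 addr0.
have nz_x := skew_plane_x_neq0 A_plane; have nz_y := skew_plane_x_neq0 yx_plane.
have cxx := central_sqrx A_plane; have cyy := central_sqrx yx_plane.
have cr (rho : {lrmorphism A -> A}) m : is_automorphism rho ->
    central m -> central (rho m).
  by case=> rho' _ rhoK' cm a; rewrite -(rhoK' a) -!rmorphM cm.
have isoE (rho : {lrmorphism A -> A}) : is_automorphism rho ->
    isotropy delta rho <->
    rho (delta x) = delta (rho x) /\ rho (delta y) = delta (rho y).
  move=> rho_aut; split=> [[_ comm] //|[commx commy]]; split=> //.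
  apply: (skew_plane_ext A_plane (r := rho)) => //.
  - by move=> c a b; rewrite !linearP.
  - by move=> c a b; rewrite !linearP.
  - by move=> a b; rewrite deltaM rmorphD !rmorphM.
  - by move=> a b; rewrite rmorphM deltaM.
split=> [mu nu rho nz_mu nz_nu rho_aut [rx ry]|mu nu eta nz_mu nz_nu eta_aut [ex ey]].
  have Ex := commute_at A_plane nz2 nz_mu nz_x cxx (cr _ _ rho_aut cl1) cl1 rx dx dx.
  have Ey := commute_at A_plane nz2 nz_nu nz_y cyy (cr _ _ rho_aut cl2) cl2 ry dy dy.
  split=> [/(isoE _ rho_aut)[/Ex[ix r1] /Ey[iy r2]]|[cw r1 r2]].
    by split=> //; exact: (central_inner A_plane ix iy).
  by apply/(isoE _ rho_aut); split; [apply/Ex|apply/Ey]; split=> //; rewrite /inner cw subrr.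
have Ex := commute_at A_plane nz2 nz_mu nz_y cyy (cr _ _ eta_aut cl1) cl2 ex dx dy.
have Ey := commute_at A_plane nz2 nz_nu nz_x cxx (cr _ _ eta_aut cl2) cl1 ey dy dx.
split=> [/(isoE _ eta_aut)[/Ex[iy r1] /Ey[ix r2]]|[cw r1 r2]].
  by split=> //; exact: (central_inner A_plane ix iy).
by apply/(isoE _ eta_aut); split; [apply/Ex|apply/Ey]; split=> //; rewrite /inner cw subrr.
Qed.
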